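(* Let $\eta\in\mathbb{R}$, $\lambda>-1/2$, $\beta>-1/2$, $d=\lambda+\beta+i\eta$, and let $\Phi_n$ be the monic orthogonal polynomials on the unit circle with respect to the weight function $$w(\theta)=e^{-\eta\theta}[\sin^2(\theta/2)]^{\lambda}[\cos^2(\theta/2)]^{\beta},\qquad 0\le\theta\le2\pi.$$ Then, for $n\ge1$, $$\begin{aligned} z(z^2-1)\Phi_n'(z)=&\{nz^2-[\ell_{n+1,n}+(d+n)\overline{\alpha}_n\alpha_{n-1}]z-(\overline d+n)\}\Phi_n(z)\\ &-[(d+n+1)\overline{\alpha}_nz+(\overline d+n)\overline{\alpha}_{n-1}]\Phi_n^*(z), \end{aligned}$$ and $$\begin{aligned} (1-z^2)(\Phi_n^* )'(z)=&[(d+n)\alpha_{n-1}z+(\overline d+n+1)\alpha_n]\Phi_n(z)\\ &+\{dz+\overline{\ell}_{n+1,n}+(\overline d+n)\alpha_n\overline{\alpha}_{n-1}\}\Phi_n^*(z). \end{aligned}$$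
   Context: The monic orthogonal polynomials $\Phi_n$ ($\deg\Phi_n=n$) are orthogonal for $\langle f,g\rangle=\int_0^{2\pi}f(e^{i\theta})\overline{g(e^{i\theta})}\,w(\theta)\,d\theta$, and are written $\Phi_n(z)=z^n+\ell_{n,n-1}z^{n-1}+\cdots+\ell_{n,0}$. Reversed polynomial: $\Phi_n^*(z)=z^n\overline{\Phi_n(1/\overline z)}$. Verblunsky coefficients: $\alpha_{n-1}=-\overline{\Phi_n(0)}$ for $n\ge1$, and $\alpha_{-1}=-1$. Prime denotes $d/dz$. *)

(* Defs.v *)
From mathcomp Require Import all_boot all_order all_algebra.
From mathcomp Require Import all_classical all_reals all_analysis.
From mathcomp Require Import complex.

Set Implicit Arguments.
Unset Strict Implicit.
Unset Printing Implicit Defensive.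

Import Order.TTheory GRing.Theory Num.Theory.
Local Open Scope ring_scope.
Local Open Scope classical_set_scope.

Definition expi (R : realType) (theta : R) : R[i] :=
  Complex (cos theta) (sin theta).

Definition cintegral (R : realType) (D : set R) (f : R -> R[i]) : R[i] :=
  Complex (\int[lebesgue_measure]_(x in D) complex.Re (f x))
          (\int[lebesgue_measure]_(x in D) complex.Im (f x)).

Definition circle_dot (R : realType) (w : R -> R) (f g : R[i] -> R[i]) : R[i] :=
  cintegral `[0, 2 * pi] (fun theta =>
    f (expi theta) * (g (expi theta))^* * real_complex R (w theta)).

Definition monic_opuc (R : realType) (w : R -> R) (Phi : nat -> {poly R[i]}) :=
  (forall n, Phi n \is monic /\ size (Phi n) = n.+1) /\
  (forall m n, m != n -> circle_dot w (horner (Phi m)) (horner (Phi n)) = 0).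

(* The reversal is taken with respect to the formal degree n, so the value at
   z = 0, where the expression in [revpolyE] is not defined, is p`_n^*. *)
Definition revpoly (R : realType) (n : nat) (p : {poly R[i]}) : {poly R[i]} :=
  \poly_(i < n.+1) (p`_(n - i))^*.

Lemma revpolyE (R : realType) (n : nat) (p : {poly R[i]}) (z : R[i]) :
  (size p <= n.+1)%N -> z != 0 ->
  (revpoly n p).[z] = z ^+ n * (p.[1 / z^*])^*.
Proof.
move=> sp z0; rewrite horner_poly (horner_coef_wide _ sp) rmorph_sum mulr_sumr.
rewrite (reindex_inj rev_ord_inj) /=; apply: eq_bigr => i _.
have le_in : (i <= n)%N by rewrite -ltnS.
rewrite subSS subKn // rmorphM rmorphXn fmorph_div rmorph1 /= conjCK div1r.
by rewrite mulrCA exprVn -expfB_cond // (negPf z0) add0n.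
Qed.

(* With natural indices, so that the convention alpha_{-1} = -1 is left out. *)
Definition verblunsky (R : realType) (Phi : nat -> {poly R[i]}) (n : nat) :
    R[i] :=
  - ((Phi n.+1).[0])^*.

(* The value at the endpoints and at pi is irrelevant when an exponent is
   negative, since these points are negligible for the integral. *)
Definition jacobi_weight (R : realType) (eta lambda beta theta : R) : R :=
  expR (- (eta * theta)) * (sin (theta / 2) ^+ 2) `^ lambda
    * (cos (theta / 2) ^+ 2) `^ beta.

(* Main.v *)
Require Import Defs.
From mathcomp Require Import all_boot all_order all_algebra.
From mathcomp Require Import all_classical all_reals all_analysis.
From mathcomp Require Import complex measurable_realfun.
From mathcomp Require Import ring lra.

Set Implicit Arguments.
Unset Strict Implicit.
Unset Printing Implicit Defensive.

Import Order.TTheory GRing.Theory Num.Theory.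
Import numFieldNormedType.Exports.
Local Open Scope ring_scope.
Local Open Scope classical_set_scope.

(** Since [lambda, beta > -1/2], the function [sin * w] vanishes at [0], [pi] and
    [2 pi], so the Pearson equation
    [(sin * w)' = ((lambda + beta + 1) cos - eta sin + lambda - beta) w]
    integrates to: for every polynomial [p] and every [j], the polynomial
    [z (z^2 - 1) p' + ((d + 2 - j) z^2 + 2 (lambda - beta) z + d^* + j) p] is
    orthogonal to [z^j].  For [p = Phi_n] this makes the difference [Q] of the two
    sides of the first identity orthogonal to [z, ..., z^n].  By the Szego
    recurrence [Q] has degree at most [n], and [Q(0) = 0]; hence [<Q, Q> = 0] and
    [Q = 0].  The second identity is the reversal of the first. *)

(** * Integrability and integration by parts against the weight *)

(** The analytic obstacle is that [w] is unbounded near [0] and [2 pi] when [lambda < 0], and near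
    [pi] when [beta < 0]. Integrability and integration by parts are therefore both reduced to one
    function with an explicit primitive, whose product with the sign of [sin] is nonnegative. As
    [sin] changes sign at [pi], this is done on each arc separately, with a sign [sigma]. On the
    algebraic side, one [Q] can serve all [j] because the Pearson polynomial depends on [j] only
    through [j (1 - z^2) p]. For [p = Phi_n] this brings in multiples of [Phi_n] and [z^2 Phi_n],
    which for [1 <= j <= n] are orthogonal to [z^j] except for [Phi_n] at [j = n] and [z^2 Phi_n] at
    [j = 1]. The term [d^* + n] disposes of the first exception, the term in [z Phi_n^*] of the
    second; the other coefficients are fixed by the degree bound and by [Q(0) = 0]. *)

(** The integrand may blow up at both ends: compact subintervals exhaust the open one, monotone
    convergence handles the integrals, and the one-sided limits of [F] handle the values. *)
Lemma ge0_continuous_FTC2_oo (R : realType) (f F : R -> R) (a b : R) : a < b ->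
  {in `]a, b[%R, forall x, 0 <= f x} ->
  {in `]a, b[%R, continuous f} ->
  derivable_oo_LRcontinuous F a b ->
  {in `]a, b[%R, F^`() =1 f} ->
  (\int[lebesgue_measure]_(x in `]a, b[) (f x)%:E = (F b)%:E - (F a)%:E)%E.
Proof.
move=> ab f0 cf [dF Fa Fb] dFE.
(* The factor one third keeps [a + e n < b - e n] already at [n = 0], where [harmonic] is [1]. *)
pose e (n : nat) : R := (b - a) / 3 * harmonic n.
have e0 n : 0 < e n by rewrite mulr_gt0// ?divr_gt0 ?subr_gt0//; exact: harmonic_gt0.
have e3 n : e n <= (b - a) / 3.
  rewrite ler_piMr//; first by rewrite divr_ge0// subr_ge0 ltW.
  by rewrite /harmonic /= invf_le1// ler1n.
have cve : e n @[n --> \oo] --> 0.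
  by rewrite -(mulr0 ((b - a) / 3)); apply: cvgMr; exact: cvg_harmonic.
have ue n : a + e n < b - e n by have := e3 n; have := e0 n; lra.
have sub n x : x \in `[a + e n, b - e n]%R -> x \in `]a, b[%R.
  by rewrite !in_itv/= => /andP[h1 h2]; have := e0 n; lra.
have key n : (\int[lebesgue_measure]_(x in `[(a + e n)%R, (b - e n)%R]) (f x)%:E
    = (F (b - e n))%:E - (F (a + e n))%:E)%E.
  have cF : {within `[a + e n, b - e n], continuous F}.
    by apply: derivable_within_continuous => x /sub; exact: dF.
  apply: continuous_FTC2 => //.
  - apply: continuous_in_subspaceT => x /[!inE] /sub; exact: cf.
  - split.
    + by move=> x xi; apply: dF; apply: (sub n); apply: subset_itv_oo_cc.
    + by move: cF => /(continuous_within_itvP _ (ue n))[].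
    + by move: cF => /(continuous_within_itvP _ (ue n))[].
  - by move=> x xi; apply: dFE; apply: (sub n); apply: subset_itv_oo_cc.
have UE : \bigcup_n `[a + e n, b - e n] = `]a, b[%classic.
  apply/seteqP; split => x /=; first by move=> [n _] /=; exact: sub.
  rewrite in_itv/= => /andP[ax xb].
  pose m := Num.min (x - a) (b - x).
  have m0 : 0 < m by rewrite lt_min !subr_gt0 ax.
  have /cvgr_dist_lt /(_ _ m0) [N _ /(_ N (leqnn N))] := cve.
  rewrite /= sub0r normrN gtr0_norm// => em; exists N => //=.
  by rewrite in_itv/=; move: em; rewrite lt_min => /andP[]; lra.
have nd : nondecreasing_seq (fun n => `[a + e n, b - e n]%classic).
  move=> m n mn; apply/subsetPset => x /=; rewrite !in_itv/=.
  have : e n <= e m.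
    rewrite ler_pM2l ?divr_gt0 ?subr_gt0// /harmonic/= lef_pV2 ?posrE//.
    by rewrite ler_nat.
  by lra.
have c1 : ((\int[lebesgue_measure]_(x in `[(a + e n)%R, (b - e n)%R]) (f x)%:E)
    @[n --> \oo] --> \int[lebesgue_measure]_(x in `]a, b[) (f x)%:E)%E.
  rewrite -UE; apply: ge0_nondecreasing_set_cvg_integral => //.
  + move=> n; apply/measurable_EFinP; apply: subspace_continuous_measurable_fun => //.
    by apply: continuous_in_subspaceT => x /[!inE] /sub; exact: cf.
  + by move=> n x /sub xi; rewrite lee_fin f0.
suff c2 : ((\int[lebesgue_measure]_(x in `[(a + e n)%R, (b - e n)%R]) (f x)%:E)
    @[n --> \oo] --> (F b)%:E - (F a)%:E)%E by exact: cvg_unique c1 c2.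
under eq_fun do rewrite key -EFinB.
rewrite -EFinB; apply: cvg_EFin; first by near=> n.
apply: cvgB.
+ move/cvg_at_leftP : Fb; apply; split.
  * by move=> n; rewrite ltrBlDr ltrDl.
  * by rewrite -[X in _ --> X]subr0; apply: cvgB => //; exact: cvg_cst.
+ move/cvg_at_rightP : Fa; apply; split.
  * by move=> n; rewrite ltrDl.
  * by rewrite -[X in _ --> X]addr0; apply: cvgD => //; exact: cvg_cst.
Unshelve. all: by end_near. Qed.

Lemma normr_sqr1 (R : realDomainType) (x : R) : x ^+ 2 = 1 -> `|x| = 1.
Proof.
by move=> x1; apply/eqP; rewrite -sqrp_eq1 ?normr_ge0// -normrX x1 normr1.
Qed.

(** * Real powers of squares, and half-angle formulas *)

Section HalfAngle.
Variable R : realType.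
Implicit Types (t p : R) (u : R -> R).

Lemma is_derive_continuous u (du t : R) :
  is_derive t 1 u du -> {for t, continuous u}.
Proof. by case=> + _ => /derivable1_diffP/differentiable_continuous. Qed.

(** Keeping the exponent [p] displays the logarithmic derivative [2 p u' / u]; raising the square
    makes one formula valid for both signs of [u]. *)
Lemma is_derive_powR_sqr u (du t p : R) : u t != 0 -> is_derive t 1 u du ->
  is_derive t 1 (fun x => (u x ^+ 2) `^ p)
    (2 * p * (u t ^+ 2) `^ p * du / u t).
Proof.
move=> u0 dut.
have u20 : 0 < u t ^+ 2 by rewrite exprn_even_gt0.
have d1 := is_derive1_powR p u20.
have d2 : is_derive t 1 (fun x => u x ^+ 2) (2 * u t * du).
  have -> : (fun x => u x ^+ 2) = u ^+ 2 by apply/funext => x; rewrite fctE.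
  by apply: is_derive_eq; rewrite /GRing.scale/= expr1.
suff <- : p * (u t ^+ 2) `^ (p - 1) * (2 * u t * du) =
    2 * p * (u t ^+ 2) `^ p * du / u t
  by apply: (@is_derive1_comp _ (@powR R ^~ p) (fun x => u x ^+ 2) _ _ _ d1 d2).
rewrite powRB; last by rewrite (gt_eqF u20) implybT.
by rewrite powRr1 ?ltW//; field.
Qed.

Lemma continuous_powR_sqr u p : 0 < p -> continuous u ->
  continuous (fun x => (u x ^+ 2) `^ p).
Proof.
move=> p0 cu t; have [u0|u0] := eqVneq (u t) 0; last first.
  apply: (@continuous_comp _ _ _ (fun x => u x ^+ 2) (@powR R ^~ p)).
    by apply: cvgM; exact: cu.
  by apply: is_derive_continuous; apply: is_derive1_powR; rewrite exprn_even_gt0.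
rewrite /continuous_at u0 expr0n/= powR0 ?gt_eqF//.
apply/cvgr0Pnorm_lt => e e0.
pose d := e `^ (p^-1 / 2).
have d0 : 0 < d by rewrite powR_gt0.
have := cu t; rewrite /continuous_at u0 => /cvgr0Pnorm_lt /(_ _ d0).
apply: filterS => x xd /=.
rewrite ger0_norm ?powR_ge0//.
have -> : e = (d ^+ 2) `^ p.
  have E1 : p^-1 / 2 * (2 * p) = 1 by field; rewrite gt_eqF.
  by rewrite -powR_mulrn ?powR_ge0// /d -!powRrM E1 powRr1// ltW.
rewrite gt0_ltr_powR// ?in_itv/= ?nnegrE ?sqr_ge0//.
by rewrite -(real_normK (num_real (u x))) ltr_pXn2r// nnegrE ?ltW.
Qed.

Lemma is_derive_sin_half t :
  is_derive t 1 (fun x : R => sin (x / 2)) (cos (t / 2) / 2).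
Proof.
have d1 : is_derive t 1 (fun x : R => x / 2) (2^-1).
  by apply: is_derive_eq; rewrite !scaler0 add0r [LHS]mulr1.
by apply: (@is_derive1_comp _ (@sin R) (fun x : R => x / 2)).
Qed.

Lemma is_derive_cos_half t :
  is_derive t 1 (fun x : R => cos (x / 2)) (- sin (t / 2) / 2).
Proof.
have d1 : is_derive t 1 (fun x : R => x / 2) (2^-1).
  by apply: is_derive_eq; rewrite !scaler0 add0r [LHS]mulr1.
by apply: (@is_derive1_comp _ (@cos R) (fun x : R => x / 2)).
Qed.

Lemma continuous_sin_half : continuous (fun x : R => sin (x / 2)).
Proof.
by move=> t; exact: is_derive_continuous (is_derive_sin_half t).
Qed.

Lemma continuous_cos_half : continuous (fun x : R => cos (x / 2)).
Proof.
by move=> t; exact: is_derive_continuous (is_derive_cos_half t).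
Qed.

Lemma sin_half t : sin t = 2 * sin (t / 2) * cos (t / 2).
Proof.
have {1}-> : t = t / 2 + t / 2 by field.
by rewrite sinD; ring.
Qed.

Lemma cos_half t : cos t = cos (t / 2) ^+ 2 - sin (t / 2) ^+ 2.
Proof.
have {1}-> : t = t / 2 + t / 2 by field.
by rewrite cosD; ring.
Qed.

End HalfAngle.

(** * Pointwise estimates and derivatives for the weight *)

Section JacobiWeight.
Variables (R : realType) (eta lambda beta : R).
Hypotheses (hl : - (1 / 2) < lambda) (hb : - (1 / 2) < beta).
Local Notation w := (jacobi_weight eta lambda beta).
Implicit Types t s : R.

Let lambda_half_gt0 : 0 < lambda + 1 / 2.
Proof. by move: hl; lra. Qed.

Let beta_half_gt0 : 0 < beta + 1 / 2.
Proof. by move: hb; lra. Qed.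

(** This passes between the exponents of the weight and those shifted by [1 / 2], which are positive
    and hence give functions continuous through the zeros. *)
Lemma powR_sqr_half (x p : R) : x != 0 ->
  (x ^+ 2) `^ (p + 1 / 2) = (x ^+ 2) `^ p * `|x|.
Proof.
move=> x0; rewrite powRD; last by rewrite sqrf_eq0 x0 implybT.
by rewrite div1r powR12_sqrt ?sqr_ge0// sqrtr_sqr.
Qed.

(* On an arc where [sin] has sign [sigma], the derivative of
   [sigma * weight_antider] dominates a multiple of the weight: this gives
   integrability at the singular points without evaluating a Beta integral. *)
Definition weight_antider t : R :=
  (sin (t / 2) ^+ 2) `^ (lambda + 1 / 2) / (lambda + 1 / 2)
  - (cos (t / 2) ^+ 2) `^ (beta + 1 / 2) / (beta + 1 / 2).

(** The derivative of [weight_antider] off the zeros of [sin]. With [s], [c] the half-angle sine and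
    cosine, its product with the sign of [sin t] is [|s|^(2 lambda) |c| + |c|^(2 beta) |s|]. *)
Definition weight_majorant t : R :=
  (sin (t / 2) ^+ 2) `^ (lambda + 1 / 2) * cos (t / 2) / sin (t / 2)
  + (cos (t / 2) ^+ 2) `^ (beta + 1 / 2) * sin (t / 2) / cos (t / 2).

(* [`|sin t| * w t], written so as to be continuous through the zeros of [sin]. *)
Definition sin_weight t : R :=
  2 * expR (- (eta * t)) * (sin (t / 2) ^+ 2) `^ (lambda + 1 / 2)
  * (cos (t / 2) ^+ 2) `^ (beta + 1 / 2).

(* The Pearson equation of the weight is [(sin * w)' = pearson * w]. *)
Definition pearson t : R :=
  (lambda + beta + 1) * cos t - eta * sin t + (lambda - beta).

Lemma sin_weight0 t : sin t = 0 -> sin_weight t = 0.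
Proof.
rewrite sin_half -mulrA => /eqP; rewrite mulf_eq0 pnatr_eq0/= mulf_eq0.
rewrite /sin_weight => /orP[] /eqP ->; rewrite expr0n/= powR0 ?mulr0 ?mul0r//;
  by rewrite gt_eqF.
Qed.

Lemma continuous_weight_antider : continuous weight_antider.
Proof.
move=> t; apply: cvgB; apply: cvgM; try exact: cvg_cst.
  by apply: continuous_powR_sqr; [by []|exact: continuous_sin_half].
by apply: continuous_powR_sqr; [by []|exact: continuous_cos_half].
Qed.

Lemma continuous_expRN : continuous (fun t : R => expR (- (eta * t))).
Proof.
move=> t; apply: (@continuous_comp _ _ _ (fun x => - (eta * x)) (@expR R)).
  by apply: cvgN; apply: cvgMr; exact: cvg_id.
exact: continuous_expR.
Qed.

Lemma continuous_sin_weight : continuous sin_weight.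
Proof.
move=> t; apply: cvgM; last first.
  by apply: continuous_powR_sqr; [by []|exact: continuous_cos_half].
apply: cvgM; last first.
  by apply: continuous_powR_sqr; [by []|exact: continuous_sin_half].
by apply: cvgMr; exact: continuous_expRN.
Qed.

(** * Angles at which [sin] has the sign [sigma], so that both arcs are treated at once *)

Section Sign.
Variables (sigma t : R).
Hypotheses (s2 : sigma ^+ 2 = 1)
  (st : 0 < sigma * (sin (t / 2) * cos (t / 2))).

Let sc0 : sigma * (sin (t / 2) * cos (t / 2)) != 0.
Proof. by rewrite gt_eqF. Qed.

Let s0 : sin (t / 2) != 0.
Proof. by move: sc0; rewrite !mulf_eq0 !negb_or => /and3P[]. Qed.

Let c0 : cos (t / 2) != 0.
Proof. by move: sc0; rewrite !mulf_eq0 !negb_or => /and3P[]. Qed.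

Let norm_sc :
  `|sin (t / 2)| * `|cos (t / 2)| = sigma * (sin (t / 2) * cos (t / 2)).
Proof. by rewrite -[RHS]gtr0_norm// !normrM (normr_sqr1 s2) mul1r. Qed.

Lemma sin_weightE : sin_weight t = sigma * sin t * w t.
Proof.
rewrite /sin_weight /w /jacobi_weight !powR_sqr_half//.
rewrite (sin_half t).
set X := _ `^ _; set Y := _ `^ _; set E := expR _.
transitivity (2 * E * X * Y * (`|sin (t / 2)| * `|cos (t / 2)|)); first by ring.
by rewrite norm_sc; ring.
Qed.

Lemma is_derive_weight_antider : is_derive t 1 weight_antider (weight_majorant t).
Proof.
have d1 := is_derive_powR_sqr (lambda + 1 / 2) s0 (is_derive_sin_half t).
have d2 := is_derive_powR_sqr (beta + 1 / 2) c0 (is_derive_cos_half t).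
apply: is_derive_eq; rewrite !scaler0 !add0r /GRing.scale/= /weight_majorant.
have l0 : lambda + 1 / 2 != 0 by rewrite gt_eqF.
have b0 : beta + 1 / 2 != 0 by rewrite gt_eqF.
set X := _ `^ _; set Y := _ `^ _.
move: (lambda + 1 / 2) l0 (beta + 1 / 2) b0 X Y => p p0 q q0 X Y.
by field; rewrite p0 q0 s0 c0.
Qed.

(** The logarithmic derivative of [sin_weight] is [- eta + (lambda + 1/2) c / s - (beta + 1/2) s /
    c]. Multiplying by [sin t = 2 s c] gives [- eta sin t + (2 lambda + 1) c^2 - (2 beta + 1) s^2],
    which is [pearson t] once its constant term is multiplied by [c^2 + s^2 = 1]. *)
Lemma is_derive_sin_weight : is_derive t 1 sin_weight (sigma * (pearson t * w t)).
Proof.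
have d1 := is_derive_powR_sqr (lambda + 1 / 2) s0 (is_derive_sin_half t).
have d2 := is_derive_powR_sqr (beta + 1 / 2) c0 (is_derive_cos_half t).
have d3 : is_derive t 1 (fun t => expR (- (eta * t))) (- eta * expR (- (eta * t))).
  have d4 : is_derive t 1 (fun t => - (eta * t)) (- eta).
    by apply: is_derive_eq; congr (- _); exact: mulr1.
  have -> : - eta * expR (- (eta * t)) = expR (- (eta * t)) * (- eta) by rewrite mulrC.
  by apply: (@is_derive1_comp _ (@expR R) (fun t => - (eta * t))).
apply: is_derive_eq; rewrite ?scaler0 ?addr0 /GRing.scale/=.
have := sin_weightE; rewrite /sin_weight /pearson (sin_half t) (cos_half t).
have -> : lambda - beta =
    (lambda - beta) * (cos (t / 2) ^+ 2 + sin (t / 2) ^+ 2).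
  by rewrite cos2Dsin2 mulr1.
move: (w t) s0 c0 => W s0' c0'.
set X := _ `^ _; set Y := _ `^ _; set E := expR _; clearbody X Y E.
move: (sin _) (cos _) s0' c0' => s c s0' c0' KE.
have {}KE : E * X * Y = sigma * s * c * W.
  by apply: (@mulfI _ 2); [rewrite pnatr_eq0|rewrite !mulrA KE; ring].
transitivity (2 * (E * X * Y) * (- eta + (lambda + 1 / 2) * c / s
    - (beta + 1 / 2) * s / c)); first by field; rewrite c0'.
by rewrite [E * X * Y]KE; field; rewrite c0'.
Qed.

(** Multiply [|s|^(2 lambda) |c|^(2 beta)] by [c^2 + s^2]. In the [c^2] term one factor
    [|c|^(2 beta + 1)] is at most [1], in the [s^2] term one factor [|s|^(2 lambda + 1)]; both
    bounds rest on the exponents being positive. *)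
Lemma le_weight_majorant : w t <= expR (- (eta * t)) * (sigma * weight_majorant t).
Proof.
rewrite /jacobi_weight /weight_majorant -mulrA ler_pM2l ?expR_gt0//.
rewrite !powR_sqr_half//.
have pC : (cos (t / 2) ^+ 2) `^ (beta + 1 / 2) <= 1.
  rewrite -[leRHS](congr1 (@^~ (beta + 1 / 2)) (powR1 R)).
  by rewrite ge0_ler_powR ?nnegrE ?sqr_ge0 ?(ltW beta_half_gt0).
have pS : (sin (t / 2) ^+ 2) `^ (lambda + 1 / 2) <= 1.
  rewrite -[leRHS](congr1 (@^~ (lambda + 1 / 2)) (powR1 R)).
  by rewrite ge0_ler_powR ?nnegrE ?sqr_ge0 ?(ltW lambda_half_gt0).
rewrite !powR_sqr_half// in pC pS.
have := cos2Dsin2 (t / 2).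
have X0 := powR_ge0 (sin (t / 2) ^+ 2) lambda.
have Y0 := powR_ge0 (cos (t / 2) ^+ 2) beta.
move: (_ `^ _) (_ `^ _) X0 Y0 pC pS => Y X X0 Y0 pC pS.
move: s0 c0 norm_sc; set s := sin _ in pS *; set c := cos _ in pC *.
clearbody s c => s0' c0' e cs.
have n1 : `|s| ^+ 2 = s ^+ 2 by rewrite real_normK ?num_real.
have n2 : `|c| ^+ 2 = c ^+ 2 by rewrite real_normK ?num_real.
have -> : sigma * (X * `|s| * c / s + Y * `|c| * s / c) = X * `|c| + Y * `|s|.
  transitivity (X * `|s| * (sigma * (s * c)) / s ^+ 2
    + Y * `|c| * (sigma * (s * c)) / c ^+ 2).
    by field; rewrite c0'.
  rewrite -e -n1 -n2; field.
  by rewrite !normr_eq0 c0'.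
rewrite -[X * Y]mulr1 -cs -n1 -n2 mulrDr lerD//.
- have -> : X * Y * `|c| ^+ 2 = X * (Y * `|c|) * `|c| by ring.
  by rewrite ler_wpM2r// ler_piMr.
- have -> : X * Y * `|s| ^+ 2 = Y * (X * `|s|) * `|s| by ring.
  by rewrite ler_wpM2r// ler_piMr.
Qed.

End Sign.
End JacobiWeight.

Lemma integrable_itv_split (R : realType) (f : R -> R) (a b c : R) :
  a <= b -> b <= c -> measurable_fun setT f ->
  lebesgue_measure.-integrable `]a, b[ (EFin \o f) ->
  lebesgue_measure.-integrable `]b, c[ (EFin \o f) ->
  lebesgue_measure.-integrable `[a, c] (EFin \o f) /\
  \int[lebesgue_measure]_(x in `[a, c]) f x =
    \int[lebesgue_measure]_(x in `]a, b[) f x +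
    \int[lebesgue_measure]_(x in `]b, c[) f x.
Proof.
move=> ab bc mf f1 f2.
have mF : measurable_fun setT (EFin \o f) by apply/measurable_EFinP.
have UE : `[a, c]%classic = `[a, b[ `|` `[b, c] by apply: itv_bndbnd_setU; rewrite bnd_simp.
have dis : [disjoint `[a, b[%classic & `[b, c]%classic].
  apply/disj_setPS => x [/=]; rewrite !in_itv/= => /andP[_ xb] /andP[bx _].
  by move: (lt_le_trans xb bx); rewrite ltxx.
have ifc : lebesgue_measure.-integrable `[a, c] (EFin \o f).
  apply/integrableP; split; first exact: measurable_funTS.
  have mN D : measurable_fun D (fun x => (`|f x|)%:E).
    by apply: measurable_funTS; apply/measurable_EFinP; apply: measurableT_comp.
  rewrite UE ge0_integral_setU//=; last exact: mN.
  rewrite (integral_itv_bndoo true true (mN _)) (integral_itv_bndoo true false (mN _)).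
  move/integrableP : f1 => [_ f1]; move/integrableP : f2 => [_ f2].
  exact: lte_add_pinfty.
split=> //; rewrite UE Rintegral_setU// -?UE//.
by congr (_ + _); rewrite /Rintegral integral_itv_bndoo//; apply: measurable_funTS.
Qed.

(** * Integration over one arc between zeros of [sin] *)

Section Arc.
Variables (R : realType) (eta lambda beta : R).
Hypotheses (hl : - (1 / 2) < lambda) (hb : - (1 / 2) < beta).
Local Notation w := (jacobi_weight eta lambda beta).
Local Notation mu := (@lebesgue_measure R).

Lemma measurable_weight : measurable_fun setT w.
Proof.
apply: measurable_funM; first apply: measurable_funM.
- apply: measurableT_comp => //.
  by apply: continuous_measurable_fun => x; apply: cvgN; apply: cvgMr; exact: cvg_id.
- apply: (@measurableT_comp _ _ _ _ _ _ (@powR R ^~ lambda)) => //.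
  apply: continuous_measurable_fun => x.
  by apply: cvgM; exact: continuous_sin_half.
- apply: (@measurableT_comp _ _ _ _ _ _ (@powR R ^~ beta)) => //.
  apply: continuous_measurable_fun => x.
  by apply: cvgM; exact: continuous_cos_half.
Qed.

Lemma weight_ge0 t : 0 <= w t.
Proof. by rewrite /jacobi_weight !mulr_ge0// ?expR_ge0// powR_ge0. Qed.

Variables (sigma a b : R).
Hypotheses (s2 : sigma ^+ 2 = 1) (ab : a < b).
Hypothesis arc : forall t, a < t < b ->
  0 < sigma * (sin (t / 2) * cos (t / 2)).
Hypotheses (sa : sin a = 0) (sb : sin b = 0).

Let s0 t : a < t < b -> sin (t / 2) != 0.
Proof. by move=> /arc/lt0r_neq0; rewrite !mulf_eq0 !negb_or => /and3P[]. Qed.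

Let c0 t : a < t < b -> cos (t / 2) != 0.
Proof. by move=> /arc/lt0r_neq0; rewrite !mulf_eq0 !negb_or => /and3P[]. Qed.

Lemma continuous_majorant t : a < t < b ->
  {for t, continuous (weight_majorant lambda beta)}.
Proof.
move=> tab; apply: cvgD; apply: cvgM.
- apply: cvgM; last exact: continuous_cos_half.
  apply: continuous_powR_sqr; [by move: hl; lra|exact: continuous_sin_half].
- by apply: cvgV; [exact: s0|exact: continuous_sin_half].
- apply: cvgM; last exact: continuous_sin_half.
  apply: continuous_powR_sqr; [by move: hb; lra|exact: continuous_cos_half].
- by apply: cvgV; [exact: c0|exact: continuous_cos_half].
Qed.

Lemma continuous_weight t : a < t < b -> {for t, continuous w}.
Proof.
move=> tab; apply: cvgM; first apply: cvgM.
- exact: continuous_expRN.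
- exact: is_derive_continuous (is_derive_powR_sqr _ (s0 tab) (is_derive_sin_half t)).
- exact: is_derive_continuous (is_derive_powR_sqr _ (c0 tab) (is_derive_cos_half t)).
Qed.

Lemma bounded_expRN : exists2 E : R, 0 < E &
  forall t, a < t < b -> expR (- (eta * t)) <= E.
Proof.
have [c _ hc] := EVT_max (ltW ab)
  (continuous_subspaceT (@continuous_expRN _ eta) (A := `[a, b]%classic)).
exists (expR (- (eta * c))); first exact: expR_gt0.
by move=> t /andP[at_ tb]; apply: hc; rewrite in_itv/= !ltW.
Qed.

Lemma majorant_ge0 t : a < t < b -> 0 <= sigma * weight_majorant lambda beta t.
Proof.
move=> tab; have := le_weight_majorant eta hl hb s2 (arc tab).
by move/(le_trans (weight_ge0 t)); rewrite pmulr_rge0// expR_gt0.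
Qed.

Lemma FTC_majorant :
  (\int[mu]_(t in `]a, b[) (sigma * weight_majorant lambda beta t)%:E =
   (sigma * weight_antider lambda beta b)%:E
   - (sigma * weight_antider lambda beta a)%:E)%E.
Proof.
have dA t : a < t < b -> is_derive t 1
    (fun t => sigma * weight_antider lambda beta t)
    (sigma * weight_majorant lambda beta t).
  move=> tab; have d := is_derive_weight_antider hl hb (arc tab).
  by apply: is_derive_eq; rewrite ?scaler0 ?addr0.
have cA : continuous (fun t => sigma * weight_antider lambda beta t).
  by move=> t; apply: cvgMr; exact: continuous_weight_antider.
apply: (@ge0_continuous_FTC2_oo _ _ (fun t => sigma * weight_antider lambda beta t)) => //.
- by move=> t; rewrite in_itv/= => /majorant_ge0.
- move=> t; rewrite in_itv/= => tab; apply: cvgMr; exact: continuous_majorant.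
- split.
  + by move=> t; rewrite in_itv/= => /dA[].
  + by apply: cvg_at_right_filter; exact: cA.
  + by apply: cvg_at_left_filter; exact: cA.
- by move=> t; rewrite in_itv/= => /dA[_ <-]; rewrite derive1E.
Qed.

Lemma integrable_majorant :
  mu.-integrable `]a, b[ (EFin \o (fun t => sigma * weight_majorant lambda beta t)).
Proof.
apply/integrableP; split.
  apply/measurable_EFinP; apply: open_continuous_measurable_fun => //.
  move=> t; rewrite inE/= in_itv/= => tab; apply: cvgMr; exact: continuous_majorant.
under eq_integral => t.
  rewrite inE/= in_itv/= => /majorant_ge0 m0; rewrite ger0_norm//.
  over.
by rewrite FTC_majorant -EFinB ltry.
Qed.

(** The same [M] yields integrability by domination and, later, the shift that makes an integrand
    nonnegative. *)
Lemma weight_le_majorant (g : R -> R) : continuous g ->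
  exists M : R, forall t, a < t < b ->
    `|g t| * w t <= M * (sigma * weight_majorant lambda beta t).
Proof.
move=> cg; have [E E0 hE] := bounded_expRN.
have cn : continuous (fun t => `|g t|) by move=> t; apply: cvg_norm; exact: cg.
have [c _ hc] := EVT_max (ltW ab) (continuous_subspaceT cn (A := `[a, b]%classic)).
exists (`|g c| * E) => t tab; rewrite -mulrA ler_pM//; first exact: weight_ge0.
  by apply: hc; rewrite in_itv/=; case/andP : tab => /ltW -> /ltW ->.
apply: (le_trans (le_weight_majorant eta hl hb s2 (arc tab))).
by rewrite ler_wpM2r ?majorant_ge0// hE.
Qed.

Lemma integrable_weight_arc (g : R -> R) : continuous g ->
  mu.-integrable `]a, b[ (EFin \o (fun t => g t * w t)).
Proof.
move=> cg; have [M hM] := weight_le_majorant cg.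
have : mu.-integrable `]a, b[
    (fun t => (M%:E * (sigma * weight_majorant lambda beta t)%:E)%E).
  by apply: integrableZl => //; exact: integrable_majorant.
apply: le_integrable => //.
  apply: measurable_funTS; apply/measurable_EFinP; apply: measurable_funM.
    exact: continuous_measurable_fun.
  exact: measurable_weight.
move=> t /=; rewrite in_itv/= => tab; rewrite lee_fin.
rewrite normrM (ger0_norm (weight_ge0 t)).
by apply: (le_trans (hM _ tab)); rewrite ler_norm.
Qed.

(** [sigma] times the integrand is the derivative of [f * sin_weight], which vanishes at both ends
    of the arc. *)
Lemma Rintegral_weight_arc (f df : R -> R) :
  (forall t : R, is_derive t 1 f (df t)) -> continuous df ->
  \int[mu]_(t in `]a, b[) ((df t * sin t + f t * pearson eta lambda beta t) * w t) = 0.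
Proof.
move=> dF cdf.
have cf : continuous f.
  by move=> t; exact: is_derive_continuous (dF t).
pose h t := df t * sin t + f t * pearson eta lambda beta t.
have ch : continuous h.
  move=> t; apply: cvgD; apply: cvgM; [exact: cdf|exact: continuous_sin|exact: cf|].
  apply: cvgD; last exact: cvg_cst.
  by apply: cvgB; apply: cvgMr; [exact: continuous_cos|exact: continuous_sin].
have [M hM] := weight_le_majorant ch.
(* Adding [M * m] makes the integrand nonnegative, so that monotone convergence
   applies up to the singular endpoints. *)
pose A t := sigma * weight_antider lambda beta t.
pose m t := sigma * weight_majorant lambda beta t.
have ftc : (\int[mu]_(t in `]a, b[) (sigma * (h t * w t) + M * m t)%:E =
    (f b * sin_weight eta lambda beta b + M * A b)%:E
    - (f a * sin_weight eta lambda beta a + M * A a)%:E)%E.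
  have dG t : a < t < b -> is_derive t 1
      (fun t => f t * sin_weight eta lambda beta t + M * A t)
      (sigma * (h t * w t) + M * m t).
    move=> tab; have d1 := is_derive_weight_antider hl hb (arc tab).
    have d2 := is_derive_sin_weight eta lambda beta s2 (arc tab).
    have d3 := dF t.
    apply: is_derive_eq; rewrite ?scaler0 ?addr0 /GRing.scale/=.
    by rewrite (sin_weightE _ _ _ s2 (arc tab)) /h /m; ring.
  have cG : continuous (fun t => f t * sin_weight eta lambda beta t + M * A t).
    move=> t; apply: cvgD.
      by apply: cvgM; [exact: cf|exact: continuous_sin_weight].
    by apply: cvgMr; apply: cvgMr; exact: continuous_weight_antider.
  apply: (@ge0_continuous_FTC2_oo _ _
    (fun t => f t * sin_weight eta lambda beta t + M * A t)) => //.
  - move=> t; rewrite in_itv/= => /hM; rewrite -/(m t) -lerBlDl sub0r.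
    apply: le_trans.
    apply: le_trans (ler_norm _) _.
    by rewrite normrN 2!normrM (normr_sqr1 s2) mul1r (ger0_norm (weight_ge0 t)).
  - move=> t; rewrite in_itv/= => tab; apply: cvgD.
      apply: cvgMr; apply: cvgM; [exact: ch|exact: continuous_weight].
    by apply: cvgMr; apply: cvgMr; exact: continuous_majorant.
  - split.
    + by move=> t; rewrite in_itv/= => /dG[].
    + by apply: cvg_at_right_filter; exact: cG.
    + by apply: cvg_at_left_filter; exact: cG.
  - by move=> t; rewrite in_itv/= => /dG[_ <-]; rewrite derive1E.
have ih := integrable_weight_arc ch.
have im := integrable_majorant.
have : \int[mu]_(t in `]a, b[) (sigma * (h t * w t) + M * m t) = M * (A b - A a).
  by rewrite /Rintegral ftc !sin_weight0// !mulr0 !add0r -EFinB/=; ring.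
rewrite RintegralD//; last 2 first.
- suff : mu.-integrable `]a, b[ (fun t => (sigma%:E * (h t * w t)%:E)%E) by [].
  exact: integrableZl.
- suff : mu.-integrable `]a, b[ (fun t => (M%:E * (m t)%:E)%E) by [].
  exact: integrableZl.
rewrite RintegralZl// RintegralZl//.
have -> : \int[mu]_(t in `]a, b[) m t = A b - A a.
  by rewrite /Rintegral FTC_majorant.
move/eqP; rewrite -subr_eq0 addrK mulf_eq0 => /orP[/eqP h0|/eqP//].
by move: s2; rewrite h0 expr0n/= => /eqP; rewrite eq_sym oner_eq0.
Qed.

End Arc.

(** * Gluing the upper and lower arcs *)

Section Circle.
Variables (R : realType) (eta lambda beta : R).
Hypotheses (hl : - (1 / 2) < lambda) (hb : - (1 / 2) < beta).
Local Notation w := (jacobi_weight eta lambda beta).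
Local Notation mu := (@lebesgue_measure R).

Let upper_arc (t : R) : 0 < t < pi ->
  0 < 1 * (sin (t / 2) * cos (t / 2)).
Proof.
move=> /andP[t0 tpi]; rewrite mul1r mulr_gt0//.
  by apply: sin_gt0_pihalf; apply/andP; split; lra.
by apply: cos_gt0_pihalf; apply/andP; split; lra.
Qed.

Let lower_arc (t : R) : pi < t < 2 * pi ->
  0 < -1 * (sin (t / 2) * cos (t / 2)).
Proof.
move=> /andP[tpi t2pi]; rewrite mulN1r -mulrN -sinBpihalf mulr_gt0//.
  by apply: sin_gt0_pi; apply/andP; split; have := pi_gt0 R; lra.
by apply: sin_gt0_pihalf; apply/andP; split; have := pi_gt0 R; lra.
Qed.

Let sqrN1 : (-1) ^+ 2 = 1 :> R.
Proof. by rewrite sqrrN expr1n. Qed.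

Let sin_2pi : sin (2 * pi) = 0 :> R.
Proof. by rewrite mulr_natl sin2pi. Qed.

Let pi_lt : pi < 2 * pi :> R.
Proof. by have := pi_gt0 R; lra. Qed.

Lemma circle_split (f : R -> R) : measurable_fun setT f ->
  mu.-integrable `]0, pi[ (EFin \o f) ->
  mu.-integrable `]pi, (2 * pi)[ (EFin \o f) ->
  mu.-integrable `[0, (2 * pi)] (EFin \o f) /\
  \int[mu]_(x in `[0, (2 * pi)]) f x =
    \int[mu]_(x in `]0, pi[) f x + \int[mu]_(x in `]pi, (2 * pi)[) f x.
Proof. by apply: integrable_itv_split; [exact: pi_ge0|exact: ltW]. Qed.

Let measurable_mul_weight (g : R -> R) : continuous g ->
  measurable_fun setT (fun t => g t * w t).
Proof.
move=> cg; apply: measurable_funM; first exact: continuous_measurable_fun.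
exact: measurable_weight.
Qed.

Let integrable_upper (g : R -> R) : continuous g ->
  mu.-integrable `]0, pi[ (EFin \o (fun t => g t * w t)).
Proof.
by apply: (integrable_weight_arc eta hl hb (expr1n _ 2) (pi_gt0 R) upper_arc).
Qed.

Let integrable_lower (g : R -> R) : continuous g ->
  mu.-integrable `]pi, (2 * pi)[ (EFin \o (fun t => g t * w t)).
Proof.
by apply: (integrable_weight_arc eta hl hb sqrN1 pi_lt lower_arc).
Qed.

Lemma integrable_weight (g : R -> R) : continuous g ->
  mu.-integrable `[0, (2 * pi)] (EFin \o (fun t => g t * w t)).
Proof.
move=> cg; apply: (circle_split _ _ _).1.
- exact: measurable_mul_weight.
- exact: integrable_upper.
- exact: integrable_lower.
Qed.

Lemma Rintegral_pearson (f df : R -> R) :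
  (forall t : R, is_derive t 1 f (df t)) -> continuous df ->
  \int[mu]_(t in `[0, (2 * pi)])
    ((df t * sin t + f t * pearson eta lambda beta t) * w t) = 0.
Proof.
move=> dF cdf.
have cf : continuous f.
  by move=> t; exact: is_derive_continuous (dF t).
have ch : continuous (fun t => df t * sin t + f t * pearson eta lambda beta t).
  move=> t; apply: cvgD; apply: cvgM; [exact: cdf|exact: continuous_sin|exact: cf|].
  apply: cvgD; last exact: cvg_cst.
  by apply: cvgB; apply: cvgMr; [exact: continuous_cos|exact: continuous_sin].
have mh := measurable_mul_weight ch.
rewrite (circle_split mh (integrable_upper ch) (integrable_lower ch)).2.
rewrite (Rintegral_weight_arc eta hl hb (expr1n _ 2) (pi_gt0 R) upper_arc
  (sin0 R) (sinpi R) dF cdf).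
rewrite (Rintegral_weight_arc eta hl hb sqrN1 pi_lt lower_arc
  (sinpi R) sin_2pi dF cdf).
by rewrite addr0.
Qed.

End Circle.

(** * The inner product on polynomials *)

Section CircleDot.
Variables (R : realType) (eta lambda beta : R).
Hypotheses (hl : - (1 / 2) < lambda) (hb : - (1 / 2) < beta).
Local Notation w := (jacobi_weight eta lambda beta).
Local Notation mu := (@lebesgue_measure R).
Local Notation C := R[i].
Local Notation Rew f := (\int[mu]_(t in `[0, (2 * pi)]) (complex.Re (f t) * w t)).
Local Notation Imw f := (\int[mu]_(t in `[0, (2 * pi)]) (complex.Im (f t) * w t)).

(** Componentwise, to match [cintegral], which integrates real and imaginary parts separately. *)
Definition ccontinuous (f : R -> C) :=
  continuous (fun t => complex.Re (f t)) /\ continuous (fun t => complex.Im (f t)).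

Lemma ccontinuousM (f g : R -> C) : ccontinuous f -> ccontinuous g ->
  ccontinuous (fun t => f t * g t).
Proof.
move=> [f1 f2] [g1 g2]; split.
  have -> : (fun t => complex.Re (f t * g t)) = (fun t =>
      complex.Re (f t) * complex.Re (g t) - complex.Im (f t) * complex.Im (g t)).
    by apply/funext => t; case: (f t) (g t) => [? ?] [? ?].
  by move=> t; apply: cvgB; apply: cvgM; [exact: f1|exact: g1|exact: f2|exact: g2].
have -> : (fun t => complex.Im (f t * g t)) = (fun t =>
    complex.Re (f t) * complex.Im (g t) + complex.Im (f t) * complex.Re (g t)).
  by apply/funext => t; case: (f t) (g t) => [? ?] [? ?].
by move=> t; apply: cvgD; apply: cvgM; [exact: f1|exact: g2|exact: f2|exact: g1].
Qed.

Lemma ccontinuousD (f g : R -> C) : ccontinuous f -> ccontinuous g ->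
  ccontinuous (fun t => f t + g t).
Proof.
move=> [f1 f2] [g1 g2]; split.
  have -> : (fun t => complex.Re (f t + g t)) = (fun t =>
      complex.Re (f t) + complex.Re (g t)).
    by apply/funext => t; case: (f t) (g t) => [? ?] [? ?].
  by move=> t; apply: cvgD; [exact: f1|exact: g1].
have -> : (fun t => complex.Im (f t + g t)) = (fun t =>
    complex.Im (f t) + complex.Im (g t)).
  by apply/funext => t; case: (f t) (g t) => [? ?] [? ?].
by move=> t; apply: cvgD; [exact: f2|exact: g2].
Qed.

Lemma ccontinuous_cst (c : C) : ccontinuous (fun=> c).
Proof. by split => t; exact: cvg_cst. Qed.

Lemma ccontinuous_conj (f : R -> C) : ccontinuous f -> ccontinuous (fun t => (f t)^*).
Proof.
move=> [f1 f2]; split.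
  have -> // : (fun t => complex.Re (f t)^*) = (fun t => complex.Re (f t)).
  by apply/funext => t; case: (f t).
have -> : (fun t => complex.Im (f t)^*) = (fun t => - complex.Im (f t)).
  by apply/funext => t; case: (f t).
by move=> t; apply: cvgN; exact: f2.
Qed.

Lemma ccontinuous_horner (p : {poly C}) : ccontinuous (fun t => p.[expi t]).
Proof.
elim/poly_ind: p => [|p c IH].
  have -> : (fun t : R => (0 : {poly C}).[expi t]) = (fun=> 0).
    by apply/funext => t; rewrite horner0.
  exact: ccontinuous_cst.
have -> : (fun t => (p * 'X + c%:P).[expi t]) = (fun t => p.[expi t] * expi t + c).
  by apply/funext => t; rewrite !hornerE.
apply: ccontinuousD; last exact: ccontinuous_cst.
apply: ccontinuousM => //.
by split; [exact: continuous_cos|exact: continuous_sin].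
Qed.

Lemma cintegralE (f : R -> C) :
  cintegral `[0, (2 * pi)] (fun t => f t * real_complex R (w t)) =
  Complex (Rew f) (Imw f).
Proof.
rewrite /cintegral; congr Complex; congr Rintegral; apply/funext => t.
  by case: (f t) => x y /=; rewrite mulr0 subr0.
by case: (f t) => x y /=; rewrite mulr0 add0r.
Qed.

(** Three terms, because the real and the imaginary part of [c * f + g] both have this shape. *)
Lemma Rintegral_lin (a b : R) (f g h : R -> R) :
  continuous f -> continuous g -> continuous h ->
  \int[mu]_(t in `[0, (2 * pi)]) ((a * f t + b * g t + h t) * w t) =
  a * \int[mu]_(t in `[0, (2 * pi)]) (f t * w t) +
  b * \int[mu]_(t in `[0, (2 * pi)]) (g t * w t) +
  \int[mu]_(t in `[0, (2 * pi)]) (h t * w t).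
Proof.
move=> cf cg ch.
have iw (u : R -> R) : continuous u ->
    mu.-integrable `[0, (2 * pi)] (EFin \o (fun t => u t * w t)).
  exact: integrable_weight.
have cZ (k : R) (u : R -> R) : continuous u -> continuous (fun t => k * u t).
  by move=> cu t; apply: cvgMr; exact: cu.
have -> : (fun t => (a * f t + b * g t + h t) * w t) =
    (fun t => (a * f t) * w t + (b * g t) * w t + h t * w t).
  by apply/funext => t; ring.
have i1 := iw _ (cZ a _ cf); have i2 := iw _ (cZ b _ cg); have i3 := iw _ ch.
rewrite RintegralD//; last first.
  suff : mu.-integrable `[0, (2 * pi)]
      (fun t => ((a * f t * w t)%:E + (b * g t * w t)%:E)%E) by [].
  exact: integrableD.
rewrite RintegralD//; congr (_ + _ + _).
  by rewrite -RintegralZl//; [congr Rintegral; apply/funext => t; ring|exact: iw].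
by rewrite -RintegralZl//; [congr Rintegral; apply/funext => t; ring|exact: iw].
Qed.

Lemma cintegral_lin (c : C) (f g : R -> C) : ccontinuous f -> ccontinuous g ->
  cintegral `[0, (2 * pi)] (fun t => (c * f t + g t) * real_complex R (w t)) =
  c * cintegral `[0, (2 * pi)] (fun t => f t * real_complex R (w t)) +
  cintegral `[0, (2 * pi)] (fun t => g t * real_complex R (w t)).
Proof.
move=> [f1 f2] [g1 g2]; rewrite !cintegralE; case: c => a b.
apply/eqP; rewrite eq_complex /=; apply/andP; split; apply/eqP.
  rewrite -[a * _ - _]/(_ + - (b * _)) -mulNr -Rintegral_lin//.
  by congr Rintegral; apply/funext => t; case: (f t) (g t) => [? ?] [? ?] /=; ring.
rewrite -Rintegral_lin//.
by congr Rintegral; apply/funext => t; case: (f t) (g t) => [? ?] [? ?] /=; ring.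
Qed.

Definition jacobi_dot (p q : {poly C}) : C := circle_dot w (horner p) (horner q).
Local Notation dot := jacobi_dot.

Lemma ccontinuous_dot (p q : {poly C}) :
  ccontinuous (fun t => p.[expi t] * (q.[expi t])^*).
Proof.
apply: ccontinuousM; first exact: ccontinuous_horner.
exact/ccontinuous_conj/ccontinuous_horner.
Qed.

Lemma dot_lin (c : C) (p q r : {poly C}) :
  dot (c *: p + q) r = c * dot p r + dot q r.
Proof.
rewrite -(cintegral_lin c (ccontinuous_dot p r) (ccontinuous_dot q r)).
rewrite /jacobi_dot /circle_dot; congr cintegral; apply/funext => t.
by rewrite hornerD hornerZ; ring.
Qed.

Lemma dotC (p q : {poly C}) : dot q p = (dot p q)^*.
Proof.
have [c1 c2] := ccontinuous_dot p q.
have c0 : continuous (fun _ : R => 0 : R) by move=> t; exact: cvg_cst.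
rewrite /jacobi_dot /circle_dot (cintegralE (fun t => p.[expi t] * (q.[expi t])^*)).
rewrite (cintegralE (fun t => q.[expi t] * (p.[expi t])^*)).
rewrite -[RHS]/(Complex _ (- _)); congr Complex.
  congr Rintegral; apply/funext => t; congr (_ * _).
  by case: (p.[_]) (q.[_]) => [? ?] [? ?] /=; ring.
rewrite -mulN1r; have := Rintegral_lin (-1) 0 c2 c0 c0.
have -> : \int[mu]_(t in `[0, (2 * pi)]) (0 * w t) = 0.
  by under eq_Rintegral do rewrite mul0r; rewrite Rintegral_cst// mul0r.
rewrite mulr0 !addr0 => <-.
congr Rintegral; apply/funext => t; congr (_ * _).
by case: (p.[_]) (q.[_]) => [? ?] [? ?] /=; ring.
Qed.

Lemma expiD (s t : R) : expi (s + t) = expi s * expi t.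
Proof. by rewrite /expi cosD sinD addrC [X in Complex _ X]addrC; congr Complex; ring. Qed.

Lemma expi0 : expi (0 : R) = 1.
Proof. by rewrite /expi cos0 sin0. Qed.

Lemma conj_expi (t : R) : (expi t)^* = expi (- t).
Proof. by rewrite /expi cosN sinN. Qed.

Lemma expiX (t : R) n : expi t ^+ n = expi (n%:R * t).
Proof.
elim: n => [|n IH]; first by rewrite mul0r expi0.
by rewrite exprS IH -expiD -natr1 mulrDl mul1r addrC.
Qed.

Lemma expi_mul_conj (t : R) : expi t * (expi t)^* = 1.
Proof. by rewrite conj_expi -expiD subrr expi0. Qed.

Lemma expi_neq0 (t : R) : expi t != 0.
Proof.
apply/eqP => e; have := expi_mul_conj t.
by rewrite e mul0r => /eqP; rewrite eq_sym oner_eq0.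
Qed.

Lemma eq_dot (p q p' q' : {poly C}) :
  (forall t, p.[expi t] * (q.[expi t])^* = p'.[expi t] * (q'.[expi t])^*) ->
  dot p q = dot p' q'.
Proof.
move=> e; rewrite /jacobi_dot /circle_dot; congr cintegral.
by apply/funext => t; rewrite e.
Qed.

Lemma dotX (p q : {poly C}) : dot ('X * p) ('X * q) = dot p q.
Proof.
apply: eq_dot => t; rewrite !hornerM !hornerX rmorphM/=.
by rewrite mulrACA expi_mul_conj mul1r.
Qed.

(** On the circle [1 / z^* = z], so the reversed polynomial is [z^n] times the conjugate of [p]. *)
Lemma dot_revpoly (n j : nat) (p : {poly C}) : (size p <= n.+1)%N -> (j <= n)%N ->
  dot (revpoly n p) 'X^j = (dot p 'X^(n - j))^*.
Proof.
move=> sp jn; rewrite -dotC; apply: eq_dot => t.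
rewrite revpolyE ?expi_neq0// !hornerXn.
have -> : 1 / (expi t)^* = expi t.
  have c0 : (expi t)^* != 0 by rewrite conj_expi expi_neq0.
  by apply: (mulIf c0); rewrite divfK// expi_mul_conj.
rewrite mulrAC; congr (_ * _).
by rewrite -{1}(subnK jn) exprD rmorphXn/= -mulrA -exprMn expi_mul_conj expr1n mulr1.
Qed.

End CircleDot.

(** * The Pearson equation for polynomials, and definiteness of the inner product *)

Section DotProperties.
Variables (R : realType) (eta lambda beta : R).
Hypotheses (hl : - (1 / 2) < lambda) (hb : - (1 / 2) < beta).
Local Notation w := (jacobi_weight eta lambda beta).
Local Notation mu := (@lebesgue_measure R).
Local Notation C := R[i].
Local Notation dot := (jacobi_dot eta lambda beta).
Local Notation d := (Complex (lambda + beta) eta : C).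

(* On the circle, [pearson_op j p] times [z^(-j) w] is twice the derivative in
   theta of [sin theta * w * z^(1 - j) * p], where [z = exp (i theta)]. *)
Definition pearson_op (j : nat) (p : {poly C}) : {poly C} :=
  'X * ('X^2 - 1) * p^`() +
  ((d + 2 - j%:R) *: 'X^2 + (2 * real_complex R (lambda - beta)) *: 'X
    + (d^* + j%:R)%:P) * p.

Lemma pearson_op_lin j (c : C) p q :
  pearson_op j (c *: p + q) = c *: pearson_op j p + pearson_op j q.
Proof.
rewrite /pearson_op derivD derivZ !mulrDr -!scalerAr scalerDr.
by rewrite !addrA; congr (_ + _); rewrite -!addrA; congr (_ + _); rewrite addrC.
Qed.

Lemma is_derive_cos_lin (k t : R) :
  is_derive t 1 (fun x : R => cos (k * x)) (- k * sin (k * t)).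
Proof.
have d1 : is_derive t 1 (fun x : R => k * x) k.
  by apply: is_derive_eq; rewrite ?scaler0 ?addr0; exact: mulr1.
have -> : - k * sin (k * t) = - sin (k * t) * k by ring.
by apply: (@is_derive1_comp _ (@cos R) (fun x : R => k * x)).
Qed.

Lemma is_derive_sin_lin (k t : R) :
  is_derive t 1 (fun x : R => sin (k * x)) (k * cos (k * t)).
Proof.
have d1 : is_derive t 1 (fun x : R => k * x) k.
  by apply: is_derive_eq; rewrite ?scaler0 ?addr0; exact: mulr1.
by rewrite mulrC; apply: (@is_derive1_comp _ (@sin R) (fun x : R => k * x)).
Qed.

Lemma dot_pearson_monomial (m j : nat) : dot (pearson_op j 'X^m) 'X^j = 0.
Proof.
(* The frequency of [z^(1 - j) z^m]; it is a real number because it may be negative. *)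
pose k : R := m%:R + 1 - j%:R.
have cs : continuous (fun t => sin (k * t)).
  by move=> t; exact: is_derive_continuous (is_derive_sin_lin k t).
have cc : continuous (fun t => cos (k * t)).
  by move=> t; exact: is_derive_continuous (is_derive_cos_lin k t).
pose F t : C := Complex
  (2 * (- k * sin (k * t) * sin t + cos (k * t) * pearson eta lambda beta t))
  (2 * (k * cos (k * t) * sin t + sin (k * t) * pearson eta lambda beta t)).
have FE t : (pearson_op j 'X^m).[expi t] * ('X^j.[expi t])^* = F t.
  have kE : expi t ^+ m.+1 * (expi t)^* ^+ j = expi (k * t).
    rewrite conj_expi !expiX -expiD /k -natr1; congr expi; ring.
  have kC : real_complex R k = m%:R + 1 - j%:R.
    by rewrite /k rmorphB rmorphD !rmorph_nat rmorph1.
  have DE : ('X^(m.-1) *+ m).[expi t] * expi t = m%:R * expi t ^+ m :> C.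
    case: m {kE kC k cs cc F} => [|m]; first by rewrite mulr0n horner0 !mul0r.
    by rewrite hornerMn hornerXn mulrnAl -exprSr mulr_natl.
  have ee := expi_mul_conj t.
  rewrite /pearson_op derivXn !hornerE rmorphXn/=.
  (* Here [d] originates: on the circle [2 * pearson] equals [(d + 1) z + (d^* + 1) z^* + 2 (lambda
     - beta)], while [2 i k sin] equals [k (z - z^* )]. *)
  transitivity ((real_complex R k + 1 + d) * expi t * expi (k * t)
     + real_complex R (2 * (lambda - beta)) * expi (k * t)
     + (d^* + 1 - real_complex R k) * (expi t)^* * expi (k * t)).
    rewrite -kE kC rmorphM rmorph_nat (exprS _ m).
    transitivity (((expi t ^+ 2 - 1) * (('X^(m.-1) *+ m).[expi t] * expi t) +
       ((d + 2 - j%:R) * expi t ^+ 2 + 2 * real_complex R (lambda - beta) * expi t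
        + (d^* + j%:R)) * expi t ^+ m) * (expi t)^* ^+ j); first by ring.
    rewrite DE; move: (expi t ^+ m) ((expi t)^* ^+ j) => x y.
    transitivity (x * y * ((m%:R + 1 - j%:R + 1 + d) * expi t ^+ 2
      + 2 * real_complex R (lambda - beta) * expi t
      + (d^* + 1 - (m%:R + 1 - j%:R)) * (expi t * (expi t)^*))).
      by rewrite ee; ring.
    by ring.
  apply/eqP; rewrite eq_complex /F /pearson /=.
  by apply/andP; split; apply/eqP; ring.
have -> : dot (pearson_op j 'X^m) 'X^j =
    cintegral `[0, (2 * pi)] (fun t => F t * real_complex R (w t)).
  by rewrite /jacobi_dot /circle_dot; congr cintegral; apply/funext => t; rewrite FE.
have dc (t : R) : is_derive t 1 (fun x : R => 2 * cos (k * x)) (2 * (- k * sin (k * t))).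
  have d1 := is_derive_cos_lin k t.
  by apply: is_derive_eq; rewrite ?scaler0 ?addr0.
have ds (t : R) : is_derive t 1 (fun x : R => 2 * sin (k * x)) (2 * (k * cos (k * t))).
  have d1 := is_derive_sin_lin k t.
  by apply: is_derive_eq; rewrite ?scaler0 ?addr0.
have cdc : continuous (fun t => 2 * (- k * sin (k * t))).
  by move=> t; apply: cvgMr; apply: cvgMr; exact: cs.
have cds : continuous (fun t => 2 * (k * cos (k * t))).
  by move=> t; apply: cvgMr; apply: cvgMr; exact: cc.
rewrite cintegralE; apply/eqP; rewrite eq_complex /=; apply/andP; split; apply/eqP.
  rewrite -[RHS](Rintegral_pearson eta hl hb dc cdc).
  by congr Rintegral; apply/funext => t; ring.
rewrite -[RHS](Rintegral_pearson eta hl hb ds cds).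
by congr Rintegral; apply/funext => t; ring.
Qed.

Lemma dot_pearson (j : nat) (p : {poly C}) : dot (pearson_op j p) 'X^j = 0.
Proof.
rewrite -[p]coefK poly_def.
have L0 : dot (pearson_op j 0) 'X^j = 0.
  have := dot_lin eta hl hb (-1) (pearson_op j 0) (pearson_op j 0) 'X^j.
  rewrite -pearson_op_lin scaler0 addr0 => ->; ring.
elim/big_ind : _ => //.
  move=> x y hx hy; rewrite -[x]scale1r pearson_op_lin (dot_lin eta hl hb) hx hy.
  by rewrite mulr0 addr0.
move=> i _; rewrite -[_ *: _]addr0 pearson_op_lin (dot_lin eta hl hb).
by rewrite dot_pearson_monomial L0 mulr0 addr0.
Qed.

(** A vanishing integral forces [|p|^2 w = 0] almost everywhere. Since [w > 0] on the upper arc,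
    that arc would be covered by a null set and the finitely many angles of roots of [p], although
    its measure is [pi]. *)
Lemma dot_eq0 (p : {poly C}) : dot p p = 0 -> p = 0.
Proof.
move=> pp0; apply/eqP/negPn/negP => p0.
pose g t : R := complex.Re p.[expi t] ^+ 2 + complex.Im p.[expi t] ^+ 2.
have g0 t : 0 <= g t by rewrite addr_ge0 ?sqr_ge0.
have cg : continuous g.
  have [c1 c2] := ccontinuous_horner p.
  by move=> t; apply: cvgD; apply: cvgM; [exact: c1|exact: c1|exact: c2|exact: c2].
have ig := integrable_weight eta hl hb cg.
have : \int[mu]_(t in `[0, (2 * pi)]) (g t * w t) = 0.
  have := cintegralE eta lambda beta (fun t => p.[expi t] * (p.[expi t])^*).
  rewrite -[cintegral _ _]/(dot p p) pp0 => /(congr1 (@complex.Re R)) /= I0.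
  rewrite [RHS]I0.
  have Re_norm (z : C) : complex.Re (z * z^*) = complex.Re z ^+ 2 + complex.Im z ^+ 2.
    by case: z => x y /=; ring.
  by congr Rintegral; apply/funext => t; rewrite Re_norm.
rewrite /Rintegral => I0.
have {}I0 : (\int[mu]_(t in `[0%R, (2 * pi)%R]) `|(g t * w t)%:E| = 0)%E.
  transitivity (\int[mu]_(t in `[0%R, (2 * pi)%R]) (g t * w t)%:E)%E; last first.
    (* A zero [Rintegral] could hide an infinite integral; integrability of [g * w] excludes
       this. *)
    by rewrite -[LHS]fineK ?I0//; exact: integrable_fin_num ig.
  apply: eq_integral => t _; rewrite /= ger0_norm// mulr_ge0//; exact: weight_ge0.
have [A [mA A0 Asub]] : {ae mu, forall t, `[0, (2 * pi)]%classic t -> (g t * w t)%:E = 0%E}.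
  apply/ae_eq_integral_abs => //.
  by case/integrableP : ig.
(* On the upper arc [acos] recovers the angle from the real part; roots off the circle only
   contribute harmless extra points. *)
pose B := (fun z : C => acos (complex.Re z)) @` [set z | root p z].
have cB : countable B.
  apply: finite_set_countable.
  apply: finite_image.
  have [rs prs] := closed_field_poly_normal p.
  apply: (@sub_finite_set _ _ [set` rs]) => [z /=|]; last exact: finite_seq.
  by rewrite prs rootZ ?lead_coef_eq0// root_prod_XsubC.
have B0 : mu B = 0%E by exact: countable_lebesgue_measure0.
have sub : `]0, pi[%classic `<=` A `|` B.
  move=> t /=; rewrite in_itv/= => /andP[t0 tpi].
  have [rt|rt] := boolP (root p (expi t)).
    right; exists (expi t) => //=; rewrite cosK// in_itv/= !ltW//.
  left; apply: Asub => /= H.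
  have /H [] : t \in `[0, (2 * pi)]%R by rewrite in_itv/= ltW//=; have := pi_gt0 R; lra.
  have w0 : 0 < w t.
    have s0 : 0 < sin (t / 2) by apply: sin_gt0_pihalf; apply/andP; split; lra.
    have c0 : 0 < cos (t / 2) by apply: cos_gt0_pihalf; apply/andP; split; lra.
    by rewrite /jacobi_weight !mulr_gt0// ?expR_gt0// powR_gt0// exprn_gt0.
  move=> /eqP; rewrite mulf_eq0 (gt_eqF w0) orbF /g paddr_eq0 ?sqr_ge0// !sqrf_eq0.
  by move: rt; rewrite rootE eq_complex /= => /negPf ->.
have mB : measurable B by exact: countable_measurable.
have n0 : mu.-negligible `]0, pi[.
  exists (A `|` B); split => //; first exact: measurableU.
  exact: null_set_setU.
have : mu `]0, pi[%classic = 0%E by apply: measure_negligible n0.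
rewrite lebesgue_measure_itv/= lte_fin pi_gt0 -EFinB subr0 => -[] pi0.
by have := pi_gt0 R; rewrite pi0 ltxx.
Qed.

End DotProperties.

(** * Szego recurrence and structure relation *)

Lemma coefX_deriv (K : nzRingType) (p : {poly K}) (i : nat) :
  ('X * p^`())`_i = p`_i *+ i.
Proof. by rewrite coefXM; case: i => //= i; rewrite coef_deriv. Qed.

Lemma revpoly_deriv (R : realType) (n : nat) (p : {poly R[i]}) (z : R[i]) :
  (size p <= n.+1)%N -> z != 0 ->
  z * ((revpoly n p)^`()).[z] = n%:R * (revpoly n p).[z]
    - z ^+ n * (z^-1 * (p^`().[1 / z^*])^*).
Proof.
move=> sp z0.
have -> : z^-1 * (p^`().[1 / z^*])^* = (('X * p^`()).[1 / z^*])^*.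
  by rewrite hornerM hornerX !div1r rmorphM fmorphV /= conjCK.
have sXp : (size ('X * p^`())%R <= n.+1)%N.
  apply/leq_sizeP => i ni; rewrite coefX_deriv nth_default ?mul0rn//.
  exact: leq_trans ni.
rewrite -revpolyE//.
have : 'X * (revpoly n p)^`() = n%:R *: revpoly n p - revpoly n ('X * p^`()).
  apply/polyP => i.
  rewrite coefX_deriv coefB coefZ !coef_poly; case: ltnP => ni; last first.
    by rewrite mul0rn mulr0 subr0.
  by rewrite coefX_deriv rmorphMn /= mulr_natl -mulrnBr ?leq_subr// subKn.
move/(congr1 (fun q => q.[z])).
by rewrite hornerM hornerX hornerD hornerN hornerZ.
Qed.

Section Opuc.
Variables (R : realType) (eta lambda beta : R).
Hypotheses (hl : - (1 / 2) < lambda) (hb : - (1 / 2) < beta).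
Local Notation C := R[i].
Local Notation dot := (jacobi_dot eta lambda beta).
Local Notation d := (Complex (lambda + beta) eta : C).
Implicit Types p q : {poly C}.

Lemma dotDl p q r : dot (p + q) r = dot p r + dot q r.
Proof. by rewrite -[p]scale1r (dot_lin eta hl hb) mul1r scale1r. Qed.

Lemma dot0l p : dot 0 p = 0.
Proof. by apply: (addrI (dot 0 p)); rewrite -dotDl !addr0. Qed.

Lemma dotZl (c : C) p q : dot (c *: p) q = c * dot p q.
Proof. by rewrite -[c *: p]addr0 (dot_lin eta hl hb) dot0l addr0. Qed.

Lemma dotBl p q r : dot (p - q) r = dot p r - dot q r.
Proof. by rewrite -scaleN1r dotDl dotZl mulN1r. Qed.

(** Testing only the support of [q] lets callers discard the index [0], or top indices whose
    coefficients cancel. *)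
Lemma dot_coef0 p q : (forall i, q`_i != 0 -> dot p 'X^i = 0) -> dot p q = 0.
Proof.
move=> h; rewrite (dotC eta hl hb) -[q]coefK poly_def.
suff -> : dot (\sum_(i < size q) q`_i *: 'X^i) p = 0 by rewrite rmorph0.
elim/big_ind : _ => [|x y hx hy|i _]; first exact: dot0l.
  by rewrite dotDl hx hy addr0.
rewrite dotZl; have [->|qi] := eqVneq q`_i 0; first by rewrite mul0r.
by rewrite (dotC eta hl hb) (h _ qi) rmorph0 mulr0.
Qed.

Lemma eq0_of_dot_monomials (n : nat) p : (size p <= n.+1)%N -> p`_0 = 0 ->
  (forall j, (0 < j <= n)%N -> dot p 'X^j = 0) -> p = 0.
Proof.
move=> sp p0 h; apply: (dot_eq0 hl hb); apply: dot_coef0 => i pi0.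
apply: h; apply/andP; split; first by case: i pi0 => //; rewrite p0 eqxx.
rewrite -ltnS; apply: leq_trans sp; rewrite ltnNge; apply: contra pi0.
by move=> h; rewrite nth_default.
Qed.

Variable Phi : nat -> {poly C}.
Hypothesis opuc : monic_opuc (jacobi_weight eta lambda beta) Phi.

Lemma opuc_size n : size (Phi n) = n.+1.
Proof. by case: opuc => /(_ n)[]. Qed.

Lemma opuc_coefn n : (Phi n)`_n = 1.
Proof.
by case: opuc => /(_ n)[/monicP + s] _; rewrite lead_coefE s.
Qed.

Lemma opuc_coef_gt n i : (n < i)%N -> (Phi n)`_i = 0.
Proof. by move=> ni; rewrite nth_default// opuc_size. Qed.

(** The hypothesis concerns only the [Phi] themselves; as [Phi j] is monic, ['X^j - Phi j] involves
    powers below [j] only, and induction on [j] applies. *)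
Lemma opuc_dot n j : (j < n)%N -> dot (Phi n) 'X^j = 0.
Proof.
elim/ltn_ind : j => j IH jn.
rewrite (dotC eta hl hb) -[X in dot X _](subrK (Phi j)) dotDl.
have -> : dot (Phi j) (Phi n) = 0 by apply: opuc.2; rewrite ltn_eqF.
rewrite addr0 (dotC eta hl hb) conjCK; apply: dot_coef0 => i.
rewrite coefB coefXn; case: (ltngtP i j) => ij.
- by move=> _; apply: IH => //; exact: ltn_trans jn.
- by rewrite opuc_coef_gt// subrr eqxx.
- by rewrite ij opuc_coefn subrr eqxx.
Qed.

Local Notation Phis n := (revpoly n (Phi n)).

Lemma opuc_rev_coef n i : (i <= n)%N -> (Phis n)`_i = ((Phi n)`_(n - i))^*.
Proof. by move=> lin; rewrite coef_poly ltnS lin. Qed.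

Lemma opuc_rev_coef_gt n i : (n < i)%N -> (Phis n)`_i = 0.
Proof. by move=> lin; rewrite coef_poly ltnS leqNgt lin. Qed.

Lemma opuc_rev_dot n j : (0 < j <= n)%N -> dot (Phis n) 'X^j = 0.
Proof.
move=> /andP[j0 jn]; rewrite dot_revpoly ?opuc_size//.
by rewrite opuc_dot ?rmorph0// ltn_subrL j0 (leq_trans j0).
Qed.

Lemma dot_mulX p j : dot ('X * p) 'X^(j.+1) = dot p 'X^j.
Proof. by rewrite exprS dotX. Qed.

(** All three polynomials are orthogonal to [z, ..., z^n]. In the difference the leading terms
    cancel by monicity, and the constant terms because [Phis n] is [1] at [0]. *)
Lemma szego n : Phi n.+1 = 'X * Phi n + (Phi n.+1)`_0 *: Phis n.
Proof.
apply/eqP; rewrite eq_sym -subr_eq0; apply/eqP.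
apply: (@eq0_of_dot_monomials n).
- apply/leq_sizeP => i ni; rewrite coefB coefD coefXM coefZ opuc_rev_coef_gt// mulr0 addr0.
  case: i ni => // i; rewrite ltnS leq_eqVlt => /predU1P[<-|ni] /=.
    by rewrite !opuc_coefn subrr.
  by rewrite !opuc_coef_gt// subrr.
- rewrite coefB coefD coefXM coefZ opuc_rev_coef// subn0 opuc_coefn rmorph1.
  by rewrite add0r mulr1 subrr.
- case=> // j jn; rewrite dotBl dotDl dotZl dot_mulX opuc_dot//.
  by rewrite opuc_rev_dot// opuc_dot ?ltnS// mulr0 addr0 subrr.
Qed.

(** The degree count below produces the subleading coefficient of [Phi n]; trading it for that of
    [Phi n.+1] turns a factor [d + n + 1] into the [d + n] of [opuc_A]. *)
Lemma opuc_ell n : (0 < n)%N ->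
  (Phi n.+1)`_n = (Phi n)`_n.-1 + (Phi n.+1)`_0 * ((Phi n)`_0)^*.
Proof.
move=> n0; rewrite {1}szego coefD coefXM coefZ opuc_rev_coef// subnn.
by rewrite gtn_eqF.
Qed.

(* Minus the coefficient of [z] in the first bracket of the theorem, the
   Verblunsky coefficients being written as [alpha_k = - (Phi_{k+1}(0))^*]. *)
Definition opuc_A n : C :=
  (Phi n.+1)`_n + (d + n%:R) * (Phi n.+1)`_0 * ((Phi n)`_0)^*.

Lemma opuc_structure n : (0 < n)%N ->
  'X * ('X^2 - 1) * (Phi n)^`()
  = (n%:R *: 'X^2 - opuc_A n *: 'X - (d^* + n%:R)%:P) * Phi n
    + (((d + n%:R + 1) * (Phi n.+1)`_0) *: 'X
       + ((d^* + n%:R) * (Phi n)`_0)%:P) * Phis n.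
Proof.
case: n => // m _; set n := m.+1.
set a := (Phi n.+1)`_0; set b := (Phi n)`_0.
apply/eqP; rewrite -subr_eq0; apply/eqP.
set Q := (X in X = 0).
have QE : Q = 'X * ('X * ('X * (Phi n)^`())) - 'X * (Phi n)^`()
    - n%:R *: ('X * ('X * Phi n)) + opuc_A n *: ('X * Phi n)
    + (d^* + n%:R) *: Phi n
    - ((d + n%:R + 1) * a) *: ('X * Phis n) - ((d^* + n%:R) * b) *: Phis n.
  rewrite /Q -!mul_polyC; ring.
have EE := coefX_deriv (Phi n).
have XS (p : {poly C}) i : ('X * p)`_i.+1 = p`_i by rewrite coefXM.
apply: (@eq0_of_dot_monomials n).
(* A priori the degree is [n + 2]. The choice of [opuc_A] cancels the coefficient of [z^(n+1)]; that
   of [z^(n+2)] is [n - n]. *)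
- apply/leq_sizeP => i ni; rewrite QE.
  move: ('X * _^`()) EE => E EE; case: i ni => [|[|i]]// im.
  rewrite !(coefB, coefD, coefZ, XS, EE) (@opuc_coef_gt n i.+2)// mul0rn.
  rewrite (@opuc_rev_coef_gt _ i.+2)// !mulr0 subr0 addr0 subr0.
  move: im; rewrite 2!ltnS leq_eqVlt => /predU1P[<-|mi].
    rewrite -/n opuc_coefn opuc_rev_coef// subnn -/b /opuc_A.
    rewrite opuc_ell// -/a -/b /= -[(Phi n)`_m *+ m]mulr_natl /n -natr1.
    by rewrite -/n; ring.
  rewrite (@opuc_coef_gt n i.+1)// opuc_rev_coef_gt// !mulr0 subr0 addr0.
  move: mi; rewrite leq_eqVlt => /predU1P[<-|mi].
    by rewrite opuc_coefn mulr1 subrr.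
  by rewrite opuc_coef_gt// mul0rn mulr0 subr0.
- rewrite QE; move: ('X * _^`()) EE => E EE.
  rewrite !(coefB, coefD, coefZ, coefXM, EE)/= mulr0n !mulr0.
  by rewrite opuc_rev_coef// subn0 opuc_coefn rmorph1 -/b; ring.
- case=> // j jn.
  have -> : Q = pearson_op eta lambda beta j.+1 (Phi n)
      - (d + 2 - j.+1%:R + n%:R) *: ('X * ('X * Phi n))
      + (opuc_A n - 2 * real_complex R (lambda - beta)) *: ('X * Phi n)
      + (n%:R - j.+1%:R) *: Phi n
      - ((d + n%:R + 1) * a) *: ('X * Phis n) - ((d^* + n%:R) * b) *: Phis n.
    rewrite /Q /pearson_op -!mul_polyC; ring.
  rewrite dotBl dotBl dotDl dotDl dotBl !dotZl (dot_pearson eta hl hb).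
  rewrite !dot_mulX opuc_dot// (@opuc_rev_dot n j.+1)//.
  (* At the exponent [n] orthogonality fails, but the factor vanishes. *)
  have -> : (n%:R - j.+1%:R) * dot (Phi n) 'X^(j.+1) = 0.
    move: jn; rewrite /= leq_eqVlt => /predU1P[->|jn]; first by rewrite subrr mul0r.
    by rewrite opuc_dot// mulr0.
  (* At the exponent [1], neither [z^2 Phi_n] nor [z Phi_n^*] is covered by orthogonality. Pairing
     the Szego recurrence with [1] relates their products, and the coefficients, both containing
     [d + n + 1], make them cancel. *)
  case: j jn => [|j] jn.
    have : dot (Phi n.+1) 'X^0 = 0 by exact: opuc_dot.
    rewrite {1}szego dotDl dotZl -/a => /eqP; rewrite addr_eq0 => /eqP ->.
    by ring.
  rewrite dot_mulX opuc_dot ?(@opuc_rev_dot n j.+1)//; first by ring.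
    exact: ltnW.
  exact: ltnW.
Qed.

Lemma opuc_structure_horner n (z : C) : (0 < n)%N ->
  z * (z ^+ 2 - 1) * ((Phi n)^`()).[z] =
    (n%:R * z ^+ 2 - opuc_A n * z - (d^* + n%:R)) * (Phi n).[z]
    + ((d + n%:R + 1) * (Phi n.+1)`_0 * z + (d^* + n%:R) * (Phi n)`_0)
      * (Phis n).[z].
Proof.
move=> n0; have := congr1 (fun p => p.[z]) (opuc_structure n0).
by rewrite !(hornerD, hornerN, hornerM, hornerZ, hornerX, hornerXn, hornerC).
Qed.

Lemma opuc_rev_structure_horner n (z : C) : (0 < n)%N ->
  (1 - z ^+ 2) * ((Phis n)^`()).[z] =
    - ((d + n%:R) * ((Phi n)`_0)^* * z
        + (d^* + n%:R + 1) * ((Phi n.+1)`_0)^*) * (Phi n).[z]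
    + (d * z + (opuc_A n)^*) * (Phis n).[z].
Proof.
move=> n0; have [->|z0] := eqVneq z 0.
  (* The reversal of the first identity only gives [z] times the claim. *)
  rewrite expr0n/= !mulr0 subr0 mul1r !add0r !horner_coef0 coef_deriv mulr1n.
  rewrite !opuc_rev_coef// subn0 opuc_coefn rmorph1 mulr1 subn1.
  rewrite /opuc_A opuc_ell// !(rmorphD, rmorphM)/= conjCK rmorph_nat; ring.
have sz := opuc_size n.
have y0 : 1 / z^* != 0 by rewrite div1r invr_eq0 fmorph_eq0.
(* Reversal amounts to conjugating the first identity at the point reflected in the unit circle. *)
have := congr1 (fun x => x^*) (opuc_structure_horner (1 / z^*) n0).
rewrite (revpolyE (n := n) _ y0) ?sz// (revpolyE (n := n) _ z0) ?sz//.
have := revpoly_deriv _ z0; move=> /(_ n (Phi n)); rewrite sz leqnn => /(_ isT).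
rewrite (revpolyE (n := n) _ z0) ?sz//.
have -> : 1 / (1 / z^*)^* = z by rewrite !div1r -fmorphV /= invrK conjCK.
have -> : (1 / z^*) = (z^-1)^* by rewrite div1r fmorphV.
rewrite !(rmorphD, rmorphM, rmorphN, rmorphB, rmorphXn, rmorph1, rmorph_nat, conjCK)/=.
rewrite !conjCK exprVn.
have u0 : z ^+ n != 0 by rewrite expf_neq0.
move: (z ^+ n) u0 => u u0; move: (((Phi n)^`()).[z^-1^*]^*) => q.
move=> h1 h2; apply: (mulfI z0); rewrite mulrCA h1.
(* Writing [1 - z^2] as [z^2 (z^-2 - 1)] exposes the left side of the conjugated identity [h2]. *)
transitivity ((1 - z ^+ 2) * n%:R * u * ((Phi n).[z^-1^*])^*
  - z ^+ 2 * u * (z^-1 * (z^-1 * z^-1 - 1) * q)); first by field.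
by rewrite h2; field; rewrite u0.
Qed.

End Opuc.

Theorem theorem4p17 (R : realType) (eta lambda beta : R)
    (Phi : nat -> {poly R[i]}) (n : nat) :
  - (1 / 2) < lambda -> - (1 / 2) < beta ->
  monic_opuc (jacobi_weight eta lambda beta) Phi ->
  (1 <= n)%N ->
  let d : R[i] := Complex (lambda + beta) eta in
  let alpha := verblunsky Phi in
  let ell : R[i] := (Phi n.+1)`_n in
  let Phis : {poly R[i]} := revpoly n (Phi n) in
  (forall z : R[i],
    z * (z ^+ 2 - 1) * ((Phi n)^`()).[z] =
      (n%:R * z ^+ 2
        - (ell + (d + n%:R) * (alpha n)^* * alpha n.-1) * z
        - (d^* + n%:R)) * (Phi n).[z]
      - ((d + n%:R + 1) * (alpha n)^* * z
        + (d^* + n%:R) * (alpha n.-1)^*) * Phis.[z]) /\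
  (forall z : R[i],
    (1 - z ^+ 2) * (Phis^`()).[z] =
      ((d + n%:R) * alpha n.-1 * z + (d^* + n%:R + 1) * alpha n) * (Phi n).[z]
      + (d * z + ell^* + (d^* + n%:R) * alpha n * (alpha n.-1)^*) * Phis.[z]).
Proof.
move=> hl hb opuc n0 d alpha ell Phis.
have aE : alpha n = - ((Phi n.+1)`_0)^* by rewrite /alpha /verblunsky horner_coef0.
(* Since [n >= 1], [n.-1] is a true predecessor and the convention for [alpha_{-1}] does not
   arise. *)
have bE : alpha n.-1 = - ((Phi n)`_0)^*.
  by rewrite /alpha /verblunsky horner_coef0 prednK.
split=> z.
  rewrite (opuc_structure_horner hl hb opuc z n0) aE bE /opuc_A.
  by rewrite !rmorphN /= !conjCK -/d -/ell; ring.
rewrite (opuc_rev_structure_horner hl hb opuc z n0) aE bE /opuc_A.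
rewrite !(rmorphN, rmorphD, rmorphM, rmorph_nat) /= !conjCK -/d -/ell; ring.
Qed.
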